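(* If $A\in M_{k_1}\otimes\dots\otimes M_{k_n}$ is a positive semidefinite Hermitian matrix with tensor rank smaller than or equal to $2$ in $M_{k_1}\otimes\dots\otimes M_{k_n}$, then $A$ is separable.
   Context: $M_k$ denotes the complex $k\times k$ matrices, and $M_{k_1}\otimes\dots\otimes M_{k_n}$ is identified with $M_{k_1\cdots k_n}$ via the Kronecker product. The tensor rank of $A\in M_{k_1}\otimes\dots\otimes M_{k_n}$ is the minimal number of elementary tensors $X_1\otimes\dots\otimes X_n$ ($X_j\in M_{k_j}$) whose sum is $A$. $A\in M_{k_1}\otimes\dots\otimes M_{k_n}$ is separable if it is a finite sum of tensors $C_1\otimes\dots\otimes C_n$ with each $C_j\in M_{k_j}$ positive semidefinite Hermitian. *)

(* Defs.v *)
From HB Require Import structures.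
From mathcomp Require Import all_boot all_order all_algebra.
From mathcomp Require Import complex mxtens boolp reals.

Set Implicit Arguments.
Unset Strict Implicit.
Unset Printing Implicit Defensive.

Import Order.TTheory GRing.Theory Num.Theory.
Local Open Scope ring_scope.
Local Open Scope sesquilinear_scope.

(* For C = R[i], 0 <= z in the partial order of C means that z is real and
   nonnegative. *)
Definition psdmx (C : numClosedFieldType) (m : nat) (A : 'M[C]_m) : Prop :=
  A \is hermsymmx /\
  forall v : 'cV[C]_m, 0 <= (v ^t* *m A *m v) (ord0 : 'I_1) (ord0 : 'I_1).

(* tensdim k = k_0 * (k_1 * ( ... * 1)) is the product of the k_j (see tensdimE);
   the recursive form makes the Kronecker product below typecheck without
   casts. *)
Fixpoint tensdim (n : nat) : ('I_n -> nat) -> nat :=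
  match n with
  | 0 => fun _ => 1%N
  | n'.+1 => fun k => (k ord0 * tensdim (fun j => k (lift ord0 j)))%N
  end.

Lemma tensdimE (n : nat) (k : 'I_n -> nat) :
  tensdim k = (\prod_(j < n) k j)%N.
Proof.
elim: n k => [|n IHn] k /=; first by rewrite big_ord0.
by rewrite big_ord_recl IHn.
Qed.

(* The Kronecker product of X_0, ..., X_(n-1); these are the elementary tensors
   of the tensor product of the matrix spaces 'M_(k j). *)
Fixpoint kronmx (C : numClosedFieldType) (n : nat) :
    forall k : 'I_n -> nat, (forall j, 'M[C]_(k j)) -> 'M[C]_(tensdim k) :=
  match n with
  | 0 => fun _ _ => 1%:M
  | n'.+1 => fun k X => X ord0 *t kronmx (fun j => X (lift ord0 j))
  end.

Definition tensor_decomposable (C : numClosedFieldType) (n : nat)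
    (k : 'I_n -> nat) (A : 'M[C]_(tensdim k)) (r : nat) : Prop :=
  exists X : 'I_r -> forall j, 'M[C]_(k j), A = \sum_(s < r) kronmx (X s).

(* r is the tensor rank of A; it exists as soon as n > 0, see tensor_rank_ex. *)
Definition is_tensor_rank (C : numClosedFieldType) (n : nat)
    (k : 'I_n -> nat) (A : 'M[C]_(tensdim k)) (r : nat) : Prop :=
  tensor_decomposable A r /\
  forall s : nat, tensor_decomposable A s -> (r <= s)%N.

Definition separable (C : numClosedFieldType) (n : nat)
    (k : 'I_n -> nat) (A : 'M[C]_(tensdim k)) : Prop :=
  exists (m : nat) (X : 'I_m -> forall j, 'M[C]_(k j)),
    (forall s j, psdmx (X s j)) /\ A = \sum_(s < m) kronmx (X s).

Lemma kronmx_ext (C : numClosedFieldType) (n : nat) (k : 'I_n -> nat)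
    (X Y : forall j, 'M[C]_(k j)) :
  (forall j, X j = Y j) -> kronmx X = kronmx Y.
Proof.
elim: n k X Y => [//|n IHn] k X Y XY /=.
by rewrite XY (IHn _ _ (fun j => Y (lift ord0 j))).
Qed.

Lemma ord_family_cons (n : nat) (T : 'I_n.+1 -> Type) (x : T ord0)
    (y : forall j, T (lift ord0 j)) :
  exists X : forall j, T j, X ord0 = x /\ forall j, X (lift ord0 j) = y j.
Proof.
pose X j : T j :=
  match unliftP ord0 j with
  | UnliftSome i e => ecast z (T z) (esym e) (y i)
  | UnliftNone e => ecast z (T z) (esym e) x
  end.
exists X; split=> [|i]; rewrite /X; case: unliftP => [i' e|e].
- by exfalso; move: (neq_lift ord0 i'); rewrite -e eqxx.
- by rewrite eq_axiomK.
- have ei := lift_inj e; case: _ / ei in e *.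
  by rewrite eq_axiomK.
- by exfalso; move: (neq_lift ord0 i); rewrite e eqxx.
Qed.

Lemma kronmx_delta (C : numClosedFieldType) (n : nat) (k : 'I_n -> nat)
    (p q : 'I_(tensdim k)) :
  exists X : forall j, 'M[C]_(k j), delta_mx p q = kronmx X.
Proof.
elim: n k p q => [|n IHn] k p q /=.
  exists (fun j => 0); apply/matrixP => i j.
  by rewrite !mxE !ord1 !eqxx.
case: (mxtens_indexP p) => p1 p2; case: (mxtens_indexP q) => q1 q2.
have [Y Yd] := IHn (fun j => k (lift ord0 j)) p2 q2.
have [X [X0 XS]] := @ord_family_cons n (fun j => 'M[C]_(k j))
  (delta_mx p1 q1) Y.
exists X; rewrite X0 (kronmx_ext XS) -Yd.
have E (m1 m2 : nat) (a c : 'I_m1) (b d : 'I_m2) :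
    (mxtens_index (a, b) == mxtens_index (c, d)) = (a == c) && (b == d).
  by rewrite (can_eq (@mxtens_indexK _ _)) xpair_eqE.
apply/matrixP => i j.
case: (mxtens_indexP i) => i1 i2; case: (mxtens_indexP j) => j1 j2.
by rewrite tensmxE !mxE !E -natrM mulnb andbACA.
Qed.

Lemma kronmx_scale (C : numClosedFieldType) (n : nat) (k : 'I_n -> nat)
    (a : C) (X : forall j, 'M[C]_(k j)) : (0 < n)%N ->
  exists Y : forall j, 'M[C]_(k j), a *: kronmx X = kronmx Y.
Proof.
case: n k X => [//|n] k X _ /=.
have [Y [Y0 YS]] := @ord_family_cons n (fun j => 'M[C]_(k j))
  (a *: X ord0) (fun j => X (lift ord0 j)).
exists Y; rewrite Y0 (kronmx_ext YS).
by apply/matrixP => i j; rewrite !mxE mulrA.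
Qed.

Lemma tensor_decomposable_ex (C : numClosedFieldType) (n : nat)
    (k : 'I_n -> nat) (A : 'M[C]_(tensdim k)) : (0 < n)%N ->
  exists r, tensor_decomposable A r.
Proof.
move=> n_gt0.
have D0 : tensor_decomposable (0 : 'M[C]_(tensdim k)) 0.
  by exists (fun _ _ => 0); rewrite big_ord0.
have DD (a : C) p q (B : 'M[C]_(tensdim k)) r : tensor_decomposable B r ->
    tensor_decomposable (a *: delta_mx p q + B) r.+1.
  move=> [X ->]; have [Z ->] := kronmx_delta C p q.
  have [Y ->] := kronmx_scale a Z n_gt0.
  exists (fun s => if unlift ord0 s is Some t then X t else Y).
  rewrite big_ord_recl unlift_none; congr (_ + _).
  by apply: eq_bigr => s _; rewrite liftK.
rewrite [A]matrix_sum_delta pair_big /=.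
elim: (index_enum _) => [|[p q] s [r IHs]].
  by exists 0; rewrite big_nil.
by exists r.+1; rewrite big_cons; apply: DD.
Qed.

Lemma tensor_rank_ex (C : numClosedFieldType) (n : nat)
    (k : 'I_n -> nat) (A : 'M[C]_(tensdim k)) : (0 < n)%N ->
  exists r, is_tensor_rank A r.
Proof.
move=> /(tensor_decomposable_ex A) [r0 Ar0].
have exP : exists r, `[< tensor_decomposable A r >].
  by exists r0; apply/asboolP.
case: (ex_minnP exP) => r /asboolP Ar min_r.
by exists r; split=> // s As; apply: min_r; apply/asboolP.
Qed.

(* Main.v *)
(* Split A over the first factor and the rest, A = X1 (x) X2 + Y1 (x) Y2.  The
   slices (I (x) w)^* A (I (x) w) are psd and lie in the span of X1 and Y1, so
   that A = p (x) D + q (x) E with p and q psd and D, E in the span of X2, Y2; if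
   X2 and Y2 are linearly dependent, A is elementary and q = 0 will do.
   Let t be the infimum of the ratio (v^* q v) / (v^* p v).  Then q - t p is psd,
   and D + t E is psd, as a limit of psd matrices; moreover
   A = p (x) (D + t E) + (q - t p) (x) E.  Repeating this with the two terms
   exchanged gives A = a (x) c + b (x) d with all four matrices psd.  Since c and d
   lie in the span of X2 and Y2, they are again sums of two elementary tensors,
   now on one factor less, and induction applies to them. *)

Require Import Defs.
From mathcomp Require Import all_boot all_order all_algebra.
From mathcomp Require Import complex mxtens classical_sets boolp reals ring lra.

Set Implicit Arguments.
Unset Strict Implicit.
Unset Printing Implicit Defensive.

Import Order.TTheory GRing.Theory Num.Theory.
Local Open Scope ring_scope.
Local Open Scope sesquilinear_scope.

(** * Quadratic forms of complex matrices *)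

Section QuadraticForm.
Variable C : numClosedFieldType.
Implicit Types m n : nat.

Definition qform m (B : 'M[C]_m) (v : 'cV[C]_m) : C :=
  (v ^t* *m B *m v) ord0 ord0.

Lemma qform0 m v : qform (0 : 'M[C]_m) v = 0.
Proof. by rewrite /qform mulmx0 mul0mx mxE. Qed.

Lemma qformD m (A B : 'M[C]_m) v : qform (A + B) v = qform A v + qform B v.
Proof. by rewrite /qform mulmxDr mulmxDl mxE. Qed.

Lemma qformZ m a (B : 'M[C]_m) v : qform (a *: B) v = a * qform B v.
Proof. by rewrite /qform -scalemxAr -scalemxAl mxE. Qed.

Lemma qformB m (A B : 'M[C]_m) v : qform (A - B) v = qform A v - qform B v.
Proof. by rewrite qformD -scaleN1r qformZ mulN1r. Qed.

Lemma qform_adj m (B : 'M[C]_m) v : qform (B ^t*) v = (qform B v)^*.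
Proof.
have -> : (qform B v)^* = ((v ^t* *m B *m v) ^t*) ord0 ord0.
  by rewrite /qform [in RHS]mxE [in RHS]mxE.
rewrite /qform !trmx_mul !map_mxM mulmxA; congr ((_ *m _ *m _) _ _).
by apply/matrixP => i j; rewrite !mxE /= conjCK.
Qed.

Lemma qform_tens m n (A : 'M[C]_m) (B : 'M[C]_n)
    (v : 'cV[C]_m) (w : 'cV[C]_n) :
  qform (A *t B) (v *t w : 'cV_(m * n)) = qform A v * qform B w.
Proof.
rewrite /qform -tensmxE -!tensmx_mul -map_mxT -trmx_tens.
(* It remains to identify [ord0] with the product index of [(ord0, ord0)]. *)
by congr (_ _ _); apply: val_inj.
Qed.

(* Polarization, with the vectors e_i + z e_j for z = 1 and z = 'i. *)
Lemma qform_eq0 m (B : 'M[C]_m) : (forall v, qform B v = 0) -> B = 0.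
Proof.
move=> B0.
have qE z i j : qform B (delta_mx i 0 + z *: delta_mx j 0) =
    B i i + z * B i j + z^* * B j i + z * z^* * B j j.
  have dE k l : ((delta_mx k 0 : 'cV[C]_m) ^t* *m B *m
      (delta_mx l 0 : 'cV[C]_m)) ord0 ord0 = B k l.
    rewrite -colE mxE.
    have -> : (delta_mx k 0 : 'cV[C]_m) ^t* = delta_mx 0 k.
      by apply/matrixP => a b; rewrite !mxE conjC_nat andbC.
    by rewrite -rowE mxE.
  have tE : (delta_mx i 0 + z *: delta_mx j 0 : 'cV[C]_m) ^t* =
      (delta_mx i 0 : 'cV[C]_m) ^t* + z^* *: (delta_mx j 0 : 'cV[C]_m) ^t*.
    by apply/matrixP => a b; rewrite !mxE rmorphD rmorphM.
  rewrite /qform tE !mulmxDl !mulmxDr.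
  rewrite -!scalemxAl -!scalemxAr.
  have addE (X Y : 'M[C]_1) : (X + Y) ord0 ord0 = X ord0 ord0 + Y ord0 ord0.
    by rewrite mxE.
  have mulE a (X : 'M[C]_1) : (a *: X) ord0 ord0 = a * X ord0 ord0.
    by rewrite mxE.
  by rewrite !addE !mulE !dE; ring.
have Bii i : B i i = 0.
  have := qE 0 i i; rewrite B0 conjC0 => ->; ring.
apply/matrixP => i j; rewrite mxE.
have := qE 1 i j; have := qE 'i i j.
rewrite !B0 !Bii conjCi conjC1 !(mulr0, add0r, addr0, mul1r) mulNr -mulrBr.
move=> /esym/eqP; rewrite mulf_eq0 (negPf (neq0Ci C)) subr_eq0 /= => /eqP <-.
by move=> /esym/eqP; rewrite -mulr2n mulrn_eq0 /= => /eqP.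
Qed.

(** Over [C] a nonnegative form is real, so [B] and its adjoint have the same form and polarization
    makes them equal. *)
Lemma psdmxP m (B : 'M[C]_m) : psdmx B <-> forall v, 0 <= qform B v.
Proof.
split=> [[] //|B_ge0]; split=> //.
apply/is_hermitianmxP; rewrite expr0 scale1r.
apply/eqP; rewrite -subr_eq0; apply/eqP/qform_eq0 => v.
by rewrite qformB qform_adj conj_Creal ?subrr ?ger0_real.
Qed.

End QuadraticForm.

Definition in_span2 (R : pzRingType) (V : lmodType R) (x y z : V) : Prop :=
  exists a b : R, z = a *: x + b *: y.

Lemma in_span2_trans (R : pzRingType) (V : lmodType R) (x y x' y' z : V) :
  in_span2 x y x' -> in_span2 x y y' -> in_span2 x' y' z -> in_span2 x y z.
Proof.
move=> [a [b ->]] [c [d ->]] [e [f ->]]; exists (e * a + f * c), (e * b + f * d).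
by rewrite !scalerDr !scalerDl !scalerA addrACA.
Qed.

(** * Psd matrices on two tensor factors *)

Section Bipartite.
Variable R : realType.
Local Notation C := R[i].
Local Open Scope complex_scope.

(** A negative value at [inf S] would force a positive slope, and then all of [S] would lie above
    the root [- a / b > inf S]. *)
Lemma affine_inf_ge0 (S : set R) (a b : R) : S !=set0%classic -> has_lbound S ->
  (forall t, S t -> 0 <= a + t * b) -> 0 <= a + inf S * b.
Proof.
move=> S0 lbS Sab; rewrite leNgt; apply/negP => lt0.
have b_gt0 : 0 < b.
  case: S0 => t St; rewrite ltNge; apply/negP => b_le0.
  have := Sab t St; have := ge_inf lbS St; nra.
suff : - a / b <= inf S by rewrite ler_pdivrMr//; lra.
by apply: lb_le_inf => // t St; rewrite ler_pdivrMr//; have := Sab t St; lra.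
Qed.

(** The order of [C] amounts to three real inequalities, a zero imaginary part being two of them. *)
Lemma affine_inf_ge0C (S : set R) (a b : C) : S !=set0%classic -> has_lbound S ->
  (forall t, S t -> 0 <= a + t%:C * b) -> 0 <= a + (inf S)%:C * b.
Proof.
case: a b => [a1 a2] [b1 b2] S0 lbS.
have E t : (0 <= (a1 +i* a2) + t%:C * (b1 +i* b2)) =
    [&& 0 <= a1 + t * b1, 0 <= a2 + t * b2 & 0 <= - a2 + t * - b2].
  rewrite lecE /= !mul0r subr0 addr0 andbC; congr (_ && _).
  by rewrite mulrN -opprD oppr_ge0 andbC -eq_le.
move=> Sab; rewrite E; apply/and3P; split; apply: affine_inf_ge0 => // t /Sab;
  by rewrite E => /and3P[].
Qed.

Lemma psd_shift m n (p q : 'M[C]_m) (D E : 'M[C]_n) :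
    psdmx p -> psdmx q ->
    (forall v w, 0 <= qform p v * qform D w + qform q v * qform E w) ->
  exists q' D', [/\ psdmx q', psdmx D', in_span2 D E D' &
    p *t D + q *t E = p *t D' + q' *t E].
Proof.
move=> /psdmxP p_ge0 psdq pq_ge0.
(* If the form of [p] vanishes there are no ratios to take an infimum of; but then [p = 0], and
   [D' = 0] works. *)
have [[v0 v0P]|p0] := pselect (exists v, qform p v != 0); last first.
  have -> : p = 0.
    by apply: qform_eq0 => v; apply/eqP/negPn/negP => pv; apply: p0; exists v.
  exists q, 0; split => //; last by rewrite !tens0mx.
    by apply/psdmxP => v; rewrite qform0.
  by exists 0, 0; rewrite !scale0r addr0.
have p_gt0 v : qform p v != 0 -> 0 < qform p v by rewrite lt0r p_ge0 andbT.
have q_ge0 := (psdmxP q).1 psdq.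
pose S := [set t : R | exists v,
  qform p v != 0 /\ t%:C = qform q v / qform p v]%classic.
have SE v : qform p v != 0 -> exists2 t, S t & t%:C = qform q v / qform p v.
  move=> pv; have r0 : qform q v / qform p v \is Num.real.
    by rewrite ger0_real// divr_ge0.
  exists (complex.Re (qform q v / qform p v)); last exact: RRe_real.
  by exists v; split=> //; apply: RRe_real.
have S0 : (S !=set0)%classic by have [t St _] := SE _ v0P; exists t.
have lbS : has_lbound S.
  by exists 0 => t [v [pv tE]]; rewrite -lecR tE divr_ge0.
exists (q - (inf S)%:C *: p), (D + (inf S)%:C *: E); split.
- apply/psdmxP => v; rewrite qformB qformZ subr_ge0.
  have [->|pv] := eqVneq (qform p v) 0; first by rewrite mulr0.
  have [t St tE] := SE v pv.
  by rewrite -ler_pdivlMr ?p_gt0// -tE lecR ge_inf.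
- apply/psdmxP => w; rewrite qformD qformZ; apply: affine_inf_ge0C => // t.
  (* At the ratio given by [v], multiplying by [qform p v > 0] yields the positivity assumed at [v]
     and [w]. *)
  move=> [v [pv ->]]; rewrite -(pmulr_rge0 _ (p_gt0 v pv)).
  rewrite mulrDr mulrA [_ * (_ / _)]mulrC divfK //.
- by exists 1, (inf S)%:C; rewrite scale1r.
- apply/matrixP => i j.
  case: (mxtens_indexP i) => i1 i2; case: (mxtens_indexP j) => j1 j2.
  by rewrite [LHS]mxE [RHS]mxE !tensmxE !mxE; ring.
Qed.

Lemma psd_tens_refactor m n (p q : 'M[C]_m) (D E : 'M[C]_n) :
    psdmx p -> psdmx q -> psdmx (p *t D + q *t E) ->
  exists a b c d, [/\ [/\ psdmx a, psdmx b, psdmx c & psdmx d],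
    in_span2 D E c, in_span2 D E d & p *t D + q *t E = a *t c + b *t d].
Proof.
move=> psdp psdq psdA.
have A_ge0 v w : 0 <= qform p v * qform D w + qform q v * qform E w.
  by rewrite -!qform_tens -qformD; apply: (psdmxP _).1.
have [q' [D' [psdq' psdD' DD' AE]]] := psd_shift psdp psdq A_ge0.
have B_ge0 v w : 0 <= qform q' v * qform E w + qform p v * qform D' w.
  by rewrite addrC -!qform_tens -qformD -AE; apply: (psdmxP _).1.
(* With the roles exchanged, the second shift changes [E] and [p] and keeps [q'] and [D'], which are
   already psd. *)
have [p' [E' [psdp' psdE' EE' BE]]] := psd_shift psdq' psdp B_ge0.
exists q', p', E', D'; split=> //.
  apply: in_span2_trans EE' => //.
  by exists 0, 1; rewrite scale0r add0r scale1r.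
by rewrite AE addrC.
Qed.

(** For [w] with [qform Z w != 0] the slice [qform Z w *: X] is psd, and the inverse scalar moves to
    [Z]. *)
Lemma psd_elementary m n (X : 'M[C]_m) (Z : 'M[C]_n) : psdmx (X *t Z) ->
  exists (p : 'M[C]_m) (a : C), psdmx p /\ X *t Z = p *t (a *: Z).
Proof.
move=> /psdmxP A_ge0.
have [[w Zw0]|Z0] := pselect (exists w, qform Z w != 0).
  exists (qform Z w *: X), (qform Z w)^-1; split.
    apply/psdmxP => v; rewrite qformZ mulrC -qform_tens; exact: A_ge0.
  apply/matrixP => i j.
  case: (mxtens_indexP i) => i1 i2; case: (mxtens_indexP j) => j1 j2.
  by rewrite !tensmxE !mxE; field.
have -> : Z = 0.
  by apply: qform_eq0 => v; apply/eqP/negPn/negP => Zv; apply: Z0; exists v.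
exists 0, 0; rewrite tens0mx tensmx0; split=> //.
by apply/psdmxP => v; rewrite qform0.
Qed.

(** Evaluate the form at product vectors [v *t w] with [w] fixed. *)
Lemma psd_slice m n (X1 Y1 : 'M[C]_m) (X2 Y2 : 'M[C]_n) w :
  psdmx (X1 *t X2 + Y1 *t Y2) -> psdmx (qform X2 w *: X1 + qform Y2 w *: Y1).
Proof.
move=> /psdmxP A_ge0; apply/psdmxP => v.
have := A_ge0 (v *t w : 'cV_(m * n)).
by rewrite !qformD !qformZ !qform_tens mulrC [X in _ + X]mulrC.
Qed.

Lemma psd_tens_rank2 m n (X1 Y1 : 'M[C]_m) (X2 Y2 : 'M[C]_n) :
    psdmx (X1 *t X2 + Y1 *t Y2) ->
  exists a b c d, [/\ [/\ psdmx a, psdmx b, psdmx c & psdmx d],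
    in_span2 X2 Y2 c, in_span2 X2 Y2 d &
    X1 *t X2 + Y1 *t Y2 = a *t c + b *t d].
Proof.
move=> psdA.
suff [p [q [D [E [psdp psdq DS ES AE]]]]] : exists p q D E, [/\ psdmx p, psdmx q,
    in_span2 X2 Y2 D, in_span2 X2 Y2 E & X1 *t X2 + Y1 *t Y2 = p *t D + q *t E].
  move: psdA; rewrite AE => /(psd_tens_refactor psdp psdq).
  move=> [a [b [c [d [psds cS dS ->]]]]]; exists a, b, c, d.
  by split=> //; [apply: in_span2_trans cS | apply: in_span2_trans dS].
pose x := qform X2; pose y := qform Y2.
have [[w [w' dt]]|dep] :=
  pselect (exists w w', x w * y w' - x w' * y w != 0).
  (* The first factors are the slices at [w] and [w']; solving for [X1] and [Y1] by Cramer's rule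
     gives the second factors. *)
  exists (x w *: X1 + y w *: Y1), (x w' *: X1 + y w' *: Y1).
  exists ((x w * y w' - x w' * y w)^-1 *: (y w' *: X2 - x w' *: Y2)).
  exists ((x w * y w' - x w' * y w)^-1 *: (x w *: Y2 - y w *: X2)).
  split; try exact: psd_slice.
  - by eexists _, _; rewrite scalerBr !scalerA -scaleNr.
  - by eexists _, _; rewrite scalerBr !scalerA -scaleNr addrC.
  apply/matrixP => i j.
  case: (mxtens_indexP i) => i1 i2; case: (mxtens_indexP j) => j1 j2.
  by rewrite [LHS]mxE [RHS]mxE !tensmxE !mxE; field.
have {}dep w w' : x w * y w' = x w' * y w.
  apply/eqP; rewrite -subr_eq0; apply/negPn/negP => dt.
  by apply: dep; exists w, w'.
(* The forms of [X2] and [Y2] are now proportional; since a matrix is determined by its form, so are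
   the matrices. *)
have [X [Z [[a [b ZE]] AE]]] :
    exists X Z, in_span2 X2 Y2 Z /\ X1 *t X2 + Y1 *t Y2 = X *t Z.
  have [[w xw0]|x0] := pselect (exists w, x w != 0).
    have Y2E : Y2 = (y w / x w) *: X2.
      apply/eqP; rewrite -subr_eq0; apply/eqP/qform_eq0 => v.
      rewrite qformB qformZ; apply: (mulfI xw0).
      by rewrite mulrBr -/(y v) dep /x; field.
    exists (X1 + (y w / x w) *: Y1), X2; split.
      by exists 1, 0; rewrite scale1r scale0r addr0.
    rewrite {1}Y2E; apply/matrixP => i j.
    case: (mxtens_indexP i) => i1 i2; case: (mxtens_indexP j) => j1 j2.
    by rewrite [LHS]mxE !tensmxE !mxE; ring.
  have -> : X2 = 0.
    by apply: qform_eq0 => v; apply/eqP/negPn/negP => xv; apply: x0; exists v.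
  exists Y1, Y2; rewrite tensmx0 add0r; split=> //.
  by exists 0, 1; rewrite scale0r add0r scale1r.
move: psdA; rewrite AE => /psd_elementary[p [t [psdp pE]]].
exists p, 0, (t *: Z), 0; split=> //.
- by apply/psdmxP => v; rewrite qform0.
- by exists (t * a), (t * b); rewrite ZE scalerDr !scalerA.
- by exists 0, 0; rewrite !scale0r addr0.
- by rewrite pE tens0mx addr0.
Qed.

(** * Separability, by induction on the number of factors *)

Lemma separable_tens n (k : 'I_n.+1 -> nat) (a : 'M[C]_(k ord0))
    (c : 'M[C]_(tensdim (fun j => k (lift ord0 j)))) :
  psdmx a -> separable c -> @separable C n.+1 k (a *t c).
Proof.
move=> psda [m [X [psdX ->]]].
have /choice[Y YE] (s : 'I_m) : exists Y : forall j, 'M[C]_(k j),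
    Y ord0 = a /\ forall j, Y (lift ord0 j) = X s j.
  exact: (@ord_family_cons n (fun j => 'M[C]_(k j)) a (X s)).
exists m, Y; split=> [s j|].
  by case: (unliftP ord0 j) => [j' ->|->]; [rewrite (YE s).2|rewrite (YE s).1].
have -> : a *t (\sum_(s < m) kronmx (X s)) = \sum_(s < m) a *t kronmx (X s).
  apply/matrixP => i j.
  case: (mxtens_indexP i) => i1 i2; case: (mxtens_indexP j) => j1 j2.
  rewrite tensmxE !summxE mulr_sumr; apply: eq_bigr => s _.
  by rewrite tensmxE.
by apply: eq_bigr => s _ /=; rewrite (YE s).1 (kronmx_ext (YE s).2).
Qed.

Lemma separableD n (k : 'I_n -> nat) (A B : 'M[C]_(tensdim k)) :
  separable A -> separable B -> separable (A + B).
Proof.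
move=> [m1 [X1 [psd1 ->]]] [m2 [X2 [psd2 ->]]].
exists (m1 + m2)%N,
  (fun s => match split s with inl i => X1 i | inr i => X2 i end).
split=> [s j|]; first by case: (split s).
rewrite big_split_ord /=; congr (_ + _); apply: eq_bigr => s _.
  by rewrite (unsplitK (inl s)).
by rewrite (unsplitK (inr s)).
Qed.

Lemma separable_kron2 n (k : 'I_n -> nat) (X Y : forall j, 'M[C]_(k j)) :
  (0 < n)%N -> psdmx (kronmx X + kronmx Y) -> separable (kronmx X + kronmx Y).
Proof.
(* The induction starts at one factor: an empty tail could not absorb the scalars in the inductive
   step. *)
case: n k X Y => // n k X Y _; elim: n k X Y => [|n IHn] k X Y psdA.
  have s1 : @separable C 0 (fun j => k (lift ord0 j)) 1%:M.
    exists 1%N, (fun _ _ => 0); rewrite big_ord1; split=> // s [].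
    by [].
  have -> : kronmx X + kronmx Y = (X ord0 + Y ord0) *t 1%:M.
    apply/matrixP => i j.
    case: (mxtens_indexP i) => i1 i2; case: (mxtens_indexP j) => j1 j2.
    by rewrite [LHS]mxE !tensmxE !mxE mulrDl.
  (* The tail is 1 by 1, so slicing at the vector [1%:M] shows that [X ord0 + Y ord0] is psd. *)
  apply: separable_tens => //; have := psd_slice 1%:M psdA.
  suff -> : qform (1%:M : 'M[C]_1) 1%:M = 1 by rewrite !scale1r.
  by rewrite /qform !mulmx1 trmx1 map_mx1 mxE.
have [a [b [c [d [[psda psdb psdc psdd] [c1 [c2 cE]] [d1 [d2 dE]] AE]]]]] :=
  psd_tens_rank2 psdA.
rewrite [_ + _]AE; apply: separableD; apply: separable_tens => //.
(* Absorbing its coefficients turns [c] into a sum of two elementary tensors, as the induction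
   hypothesis requires. *)
- have [X' X'E] := kronmx_scale c1 (fun j => X (lift ord0 j)) (ltn0Sn n).
  have [Y' Y'E] := kronmx_scale c2 (fun j => Y (lift ord0 j)) (ltn0Sn n).
  by move: psdc; rewrite cE X'E Y'E; apply: IHn.
- have [X' X'E] := kronmx_scale d1 (fun j => X (lift ord0 j)) (ltn0Sn n).
  have [Y' Y'E] := kronmx_scale d2 (fun j => Y (lift ord0 j)) (ltn0Sn n).
  by move: psdd; rewrite dE X'E Y'E; apply: IHn.
Qed.

End Bipartite.

Theorem corollary4p8 (R : realType) (n : nat) (k : 'I_n -> nat)
    (A : 'M[R[i]]_(tensdim k)) (r : nat) :
  (0 < n)%N -> psdmx A -> is_tensor_rank A r -> (r <= 2)%N -> separable A.
Proof.
move=> n_gt0 psdA [[X AE] _] r_le2.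
(* Zero is an elementary tensor; it pads a shorter sum to two terms. *)
have [Z Z0] := kronmx_scale 0 (fun j => (0 : 'M[R[i]]_(k j))) n_gt0.
rewrite scale0r in Z0.
suff [Y [Y' YE]] : exists Y Y', A = kronmx Y + kronmx Y'.
  by move: psdA; rewrite YE; apply: separable_kron2.
case: r X AE r_le2 => [|[|[|//]]] X -> _.
- by exists Z, Z; rewrite big_ord0 -Z0 addr0.
- by exists (X ord0), Z; rewrite big_ord1 -Z0 addr0.
- by exists (X ord0), (X (lift ord0 ord0)); rewrite big_ord_recl big_ord1.
Qed.
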